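(* Let $m,n$ be integers with $m\ge2$ and $m$ dividing $n$, and let $f:\mathbb{Z}/n\mathbb{Z}\to\mathbb{Z}/m\mathbb{Z}$. The following conditions are equivalent: (1) $f$ is congruence preserving, i.e. for all $x,y\in\mathbb{Z}/n\mathbb{Z}$, $\pi_{n,m}(x-y)$ divides $f(x)-f(y)$ in $\mathbb{Z}/m\mathbb{Z}$; (2) there is a congruence preserving function $F:\mathbb{N}\to\mathbb{N}$ with $\pi_m\circ F=f\circ\pi_n$ on $\mathbb{N}$; (3) there is a congruence preserving function $F:\mathbb{N}\to\mathbb{Z}$ with $\pi_m\circ F=f\circ\pi_n$ on $\mathbb{N}$.
   Context: For $k\ge1$: $\pi_k:\mathbb{Z}\to\mathbb{Z}/k\mathbb{Z}$ is the canonical surjective homomorphism; $\iota_k:\mathbb{Z}/k\mathbb{Z}\to\mathbb{N}$ maps a class to its representative in $\{0,\dots,k-1\}$; $\pi_{n,m}=\pi_m\circ\iota_n:\mathbb{Z}/n\mathbb{Z}\to\mathbb{Z}/m\mathbb{Z}$. A function $F$ from $\mathbb{N}$ to $\mathbb{N}$ (or to $\mathbb{Z}$) is congruence preserving if for all $a,b\in\mathbb{N}$, $a-b$ divides $F(a)-F(b)$ in $\mathbb{Z}$. *)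

(* Defs.v *)
From mathcomp Require Import all_boot all_order all_algebra.

Set Implicit Arguments.
Unset Strict Implicit.
Unset Printing Implicit Defensive.

Import GRing.Theory.
Local Open Scope ring_scope.

(* Z/kZ is 'Z_k, which has the intended meaning only when 1 < k. *)

Definition proj (k : nat) (z : int) : 'Z_k := z%:~R.

(* The elements of 'Z_k are ordinals, so the representative of a class in
   {0, ..., k-1} is its underlying natural number. *)
Definition repr_nat (k : nat) (x : 'Z_k) : nat := x.

Definition proj2 (n m : nat) (x : 'Z_n) : 'Z_m := proj m (repr_nat x)%:Z.

Definition ring_divides (R : comPzRingType) (a b : R) : Prop :=
  exists c : R, b = a * c.

Definition Zmod_congruence_preserving (n m : nat) (f : 'Z_n -> 'Z_m) : Prop :=
  forall x y : 'Z_n, ring_divides (proj2 m (x - y)) (f x - f y).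

(* In dvdz, 0 divides only 0. *)
Definition congruence_preserving (F : nat -> int) : Prop :=
  forall a b : nat, (a%:Z - b%:Z %| F a - F b)%Z.

(* Main.v *)
Require Import Defs.
From mathcomp Require Import all_boot all_order all_algebra.
From mathcomp Require Import ring.

Set Implicit Arguments.
Unset Strict Implicit.
Unset Printing Implicit Defensive.

Import GRing.Theory.
Local Open Scope ring_scope.

(** The only substantial implication lifts [f] to [F], and [F k] is built by
    strong recursion on [k]. The value [F k] has to satisfy [F k = F i] modulo
    [k - i] for all [i < k], and [F k = f k] modulo [m]. These congruences are
    pairwise compatible: [gcd (k - i, k - j)] divides [i - j], hence
    [F i - F j]; and [gcd (k - i, m)] divides [f k - f i] because [f] is
    congruence preserving. The Chinese remainder theorem for moduli that need
    not be coprime therefore yields a natural number [F k]. *)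

(** By Bezout, [x - y = q * (u * a + v * b)], so [x - q * u * a] and [y + q * v * b] are the same
    number. *)
Lemma chinese2 (a b : nat) (x y : int) :
  ((gcdn a b)%:Z %| x - y)%Z ->
  exists z : int, (a%:Z %| z - x)%Z /\ (b%:Z %| z - y)%Z.
Proof.
move=> /dvdzP[q xyE]; have [u [v]] := Bezoutz a b.
rewrite /gcdz !absz_nat => uvE.
exists (x - q * u * a%:Z); split; apply/dvdzP.
  by exists (- (q * u)); ring.
exists (q * v); transitivity (x - y - q * u * a%:Z); first by ring.
by rewrite xyE -uvE; ring.
Qed.

Lemma lcmn_dvdz (a b : nat) (c : int) :
  ((lcmn a b)%:Z %| c)%Z = (a%:Z %| c)%Z && (b%:Z %| c)%Z.
Proof. by rewrite !dvdzE dvdn_lcm. Qed.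

(** Induction on [s]: a solution [x] for the tail is merged with the head by [chinese2], the tail
    acting as one congruence modulo its lcm [L s]. The compatibility needed there reduces to the
    pairwise one, since gcd distributes over lcm ([L_gcd]). *)
Lemma chinese_compatible (s : seq (nat * int)) :
  {in s &, forall p q, ((gcdn p.1 q.1)%:Z %| p.2 - q.2)%Z} ->
  exists x : int, {in s, forall p, (p.1%:Z %| x - p.2)%Z}.
Proof.
pose L (t : seq (nat * int)) := \big[lcmn/1%N]_(p <- t) p.1.
have L_dvd t (c : int) :
    (forall p, p \in t -> (p.1%:Z %| c)%Z) -> ((L t)%:Z %| c)%Z.
  rewrite /L; elim: t => [|p t IHt] tc; first by rewrite big_nil dvd1z.
  rewrite big_cons lcmn_dvdz (tc p) ?mem_head //=.
  by apply: IHt => q qt; apply: tc; rewrite inE qt orbT.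
have dvd_L t p : p \in t -> (p.1%:Z %| (L t)%:Z)%Z.
  rewrite /L; elim: t => [//|q t IHt]; rewrite inE big_cons dvdzE /=.
  case/predU1P=> [->|/IHt pt]; first exact: dvdn_lcml.
  exact: dvdn_trans pt (dvdn_lcmr _ _).
have L_gcd t d (c : int) :
    (forall p, p \in t -> ((gcdn p.1 d)%:Z %| c)%Z) ->
    ((gcdn (L t) d)%:Z %| c)%Z.
  rewrite /L; elim: t => [|p t IHt] tc; first by rewrite big_nil gcd1n dvd1z.
  rewrite big_cons Order.NatDvd.meetUl lcmn_dvdz.
  apply/andP; split; first by apply: tc; rewrite mem_head.
  by apply: IHt => q qt; apply: tc; rewrite inE qt orbT.
elim: s => [|p s IHs] sP; first by exists 0.
have [|x xP] := IHs.
  by move=> q r qs rs; apply: sP; rewrite inE ?qs ?rs orbT.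
have /chinese2[z [zx zp]] : ((gcdn (L s) p.1)%:Z %| x - p.2)%Z.
  apply: L_gcd => q qs; rewrite -(subrKA q.2) rpredD //.
    by apply: dvdz_trans (xP q qs); exact: dvdn_gcdl.
  by apply: sP; rewrite ?mem_head // inE qs orbT.
exists z => q; rewrite inE => /predU1P[->//|qs].
by rewrite -(subrKA x) rpredD ?xP // (dvdz_trans (dvd_L s q qs)).
Qed.

Lemma chinese_compatible_nat (s : seq (nat * int)) :
  {in s, forall p, (0 < p.1)%N} ->
  {in s &, forall p q, ((gcdn p.1 q.1)%:Z %| p.2 - q.2)%Z} ->
  exists x : nat, {in s, forall p, (p.1%:Z %| x%:Z - p.2)%Z}.
Proof.
move=> s_gt0 /chinese_compatible[x xP].
pose M := (\prod_(p <- s) p.1)%N.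
have M_neq0 : M%:Z != 0.
  rewrite eqz_nat -lt0n /M big_seq; apply: prodn_cond_gt0 => p; exact: s_gt0.
(* Reducing modulo the product of all moduli makes the solution nonnegative and preserves every
   congruence. *)
exists `|(x %% M)%Z|%N => p ps; rewrite gez0_abs ?modz_ge0 //.
rewrite -(subrKA x) rpredD ?xP //.
have -> : ((x %% M)%Z - x) = - ((x %/ M)%Z * M).
  by rewrite {2}(divz_eq x M); ring.
rewrite rpredN dvdz_mull // /M (big_rem p) //=.
by rewrite dvdzE /= dvdn_mulr.
Qed.

(** Strong recursion in which each new value may depend on all earlier ones. The extension is given
    as a sigma type, so iterating it needs no choice axiom. *)
Lemma prefix_choice (T : Type) (x0 : T) (P : seq T -> Prop) :
  P [::] -> (forall s, P s -> {x | P (rcons s x)}) ->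
  exists F : nat -> T, forall k, P (mkseq F k).
Proof.
move=> P0 PS.
pose step (s : {s | P s}) : {s | P s} :=
  let: exist x Px := PS (sval s) (svalP s) in exist P (rcons (sval s) x) Px.
pose u k := sval (iter k step (exist P [::] P0)).
have uS k : exists x, u k.+1 = rcons (u k) x.
  by rewrite /u /= /step; case: (PS _ _) => x Px; exists x.
have size_u k : size (u k) = k.
  by elim: k => [//|k IHk]; have [x ->] := uS k; rewrite size_rcons IHk.
exists (fun k => nth x0 (u k.+1) k) => k.
suff -> : mkseq (fun i => nth x0 (u i.+1) i) k = u k by exact: svalP.
elim: k => [//|k IHk]; rewrite mkseqS IHk.
by have [x ->] := uS k; rewrite nth_rcons size_u ltnn eqxx.
Qed.

Lemma congruence_preserving_lift (m : nat) (g : nat -> int) :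
  (0 < m)%N ->
  (forall a b : nat, (gcdz (a%:Z - b%:Z) m%:Z %| g a - g b)%Z) ->
  exists F : nat -> nat,
    congruence_preserving (fun a => (F a)%:Z) /\
    (forall a, (m%:Z %| (F a)%:Z - g a)%Z).
Proof.
move=> m_gt0 gP.
(* [R s k x]: [x] is an admissible value at [k] after the first [k] entries of [s]. It is boolean so
   that [sigW] can extract a witness. *)
pose R (s : seq nat) k (x : nat) := (m%:Z %| x%:Z - g k)%Z &&
  all (fun i => (k%:Z - i%:Z %| x%:Z - (nth 0%N s i)%:Z)%Z) (iota 0 k).
pose P s := forall k, (k < size s)%N -> R s k (nth 0%N s k).
have Pdvd s i j : P s -> (i < size s)%N -> (j < size s)%N ->
    (i%:Z - j%:Z %| (nth 0%N s i)%:Z - (nth 0%N s j)%:Z)%Z.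
  move=> Ps; wlog ji : i j / (j < i)%N => [hw|] si sj.
    have [/hw|/hw ij|->] := ltngtP j i; [exact | | by rewrite !subrr].
    rewrite -(opprB j%:Z) dvdzE abszN -dvdzE.
    by rewrite -(opprB (nth 0%N s j)%:Z) rpredN ij.
  by have /andP[_ /allP] := Ps i si; apply; rewrite mem_iota.
have PS s : P s -> {x | P (rcons s x)}.
  move=> Ps; have [x Rx] : {x | R s (size s) x}.
    apply: sigW; set k := size s.
    pose c := (m, g k) :: [seq ((k - i)%N, (nth 0%N s i)%:Z) | i <- iota 0 k].
    (* Compatibility with the congruence modulo [m], passing through [g i]. *)
    have km i : (i < k)%N ->
        ((gcdn (k - i) m)%:Z %| (nth 0%N s i)%:Z - g k)%Z.
      move=> ik; rewrite -(subrKA (g i)) rpredD //.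
        have /andP[+ _] := Ps i ik; apply: dvdz_trans; exact: dvdn_gcdr.
      by rewrite -opprB rpredN; have := gP k i; rewrite subzn // ltnW.
    have [p|p q|x xP] := @chinese_compatible_nat c.
    - rewrite inE => /predU1P[->//|/mapP[i]].
      by rewrite mem_iota /= add0n => ik ->; rewrite subn_gt0.
    - rewrite !inE => pc qc.
      case/predU1P: pc => [->|/mapP[i + ->]];
        case/predU1P: qc => [->|/mapP[j + ->]]; rewrite ?mem_iota ?add0n /=.
      + by rewrite subrr.
      + by move=> jk; rewrite gcdnC -opprB rpredN km.
      + exact: km.
      + move=> jk ik; apply: dvdz_trans (Pdvd s i j Ps ik jk).
        have -> : i%:Z - j%:Z = (k - j)%N%:Z - (k - i)%N%:Z.
          by rewrite -!subzn 1?ltnW //; ring.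
        by rewrite rpredB // dvdzE /= ?dvdn_gcdl ?dvdn_gcdr.
    exists x; apply/andP; split; first exact: (xP (m, g k) (mem_head _ _)).
    apply/allP => i; rewrite mem_iota add0n /= => ik.
    rewrite (subzn (ltnW ik)); apply: (xP ((k - i)%N, (nth 0%N s i)%:Z)).
    by rewrite inE; apply/orP; right; apply/mapP; exists i; rewrite ?mem_iota.
  exists x => k; rewrite size_rcons ltnS => ks.
  (* [R] at [k] reads only entries of index below [k], which [rcons] leaves unchanged. *)
  set y := nth _ _ k; suff : R s k y.
    congr (_ && _); apply: eq_in_all => i; rewrite mem_iota add0n /= => ik.
    by rewrite nth_rcons (leq_trans ik ks).
  by rewrite /y nth_rcons; case: ltngtP ks => [/Ps| |->].
have [//|F FP] := @prefix_choice nat 0%N P _ PS.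
exists F; split=> [a b|a].
  (* A prefix of length [a + b + 1] contains both indices. *)
  have := Pdvd _ a b (FP (a + b).+1); rewrite size_mkseq !ltnS.
  by rewrite leq_addr leq_addl !nth_mkseq ?ltnS ?leq_addr ?leq_addl //; apply.
have := FP a.+1 a; rewrite size_mkseq nth_mkseq ?ltnSn //.
by move=> /(_ isT)/andP[].
Qed.

Lemma proj_eq0 (k : nat) (z : int) :
  (1 < k)%N -> (proj k z == 0) = (k%:Z %| z)%Z.
Proof.
move=> k_gt1; rewrite /proj.
have natE (i : nat) : (i%:R == 0 :> 'Z_k) = (k %| i)%N.
  by rewrite -val_eqE /= val_Zp_nat.
by case: z => i; rewrite ?NegzE ?mulrNz ?oppr_eq0 ?rpredN natE.
Qed.

Lemma proj_eq (k : nat) (x y : int) :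
  (1 < k)%N -> (proj k x == proj k y) = (k%:Z %| x - y)%Z.
Proof. by move=> k_gt1; rewrite -proj_eq0 // /proj rmorphB subr_eq0. Qed.

Lemma proj_repr_nat (k : nat) (x : 'Z_k) : proj k (repr_nat x)%:Z = x.
Proof. exact: natr_Zp. Qed.

(** An integer and its representative modulo [n] differ by a multiple of [n], hence of [m]. *)
Lemma proj2_proj (m n : nat) (z : int) :
  (1 < m)%N -> (1 < n)%N -> (m %| n)%N -> proj2 m (proj n z) = proj m z.
Proof.
move=> m_gt1 n_gt1 mn; apply/eqP; rewrite proj_eq //.
by apply: (@dvdz_trans n) => //; rewrite -proj_eq // proj_repr_nat.
Qed.

Theorem theorem7 (m n : nat) (hm : (2 <= m)%N) (hn : (1 <= n)%N)
    (hmn : (m %| n)%N) (f : 'Z_n -> 'Z_m) :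
  [<-> Zmod_congruence_preserving f;
       exists F : nat -> nat,
         congruence_preserving (fun a : nat => (F a)%:Z) /\
         (forall a : nat, proj m (F a)%:Z = f (proj n a%:Z));
       exists F : nat -> int,
         congruence_preserving F /\
         (forall a : nat, proj m (F a) = f (proj n a%:Z))].
Proof.
have n_gt1 : (1 < n)%N by rewrite (leq_trans hm) // dvdn_leq.
split; [move=> fP | split; [case=> F [FP Ff] | case=> F [FP Ff] x y]].
- pose g a : int := (repr_nat (f (proj n a%:Z)))%:Z.
  have [|a b|F [FP Fg]] := @congruence_preserving_lift m g.
  + exact: ltnW.
  + have [c] := fP (proj n a%:Z) (proj n b%:Z).
    rewrite /proj -rmorphB /= -/(proj n _) proj2_proj //.
    (* Passing to representatives turns the equation in ['Z_m] into a divisibility by [m] over the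
       integers. *)
    rewrite -(proj_repr_nat c) -[f _]proj_repr_nat -[f (b%:Z%:~R)]proj_repr_nat.
    rewrite /proj -rmorphM -rmorphB => /eqP.
    rewrite -/(proj m _) -[X in _ == X]/(proj m _) proj_eq // => H.
    rewrite -(subrK ((a%:Z - b%:Z) * (repr_nat c)%:Z) (g a - g b)) rpredD //.
      exact: dvdz_trans (dvdz_gcdr _ _) H.
    by rewrite dvdz_mulr // dvdz_gcdl.
  + exists F; split=> // a; rewrite -[RHS]proj_repr_nat; apply/eqP.
    by rewrite proj_eq ?Fg.
- by exists (fun a => (F a)%:Z).
(* The class of the integer quotient [q] is the required cofactor in ['Z_m]. *)
- have /dvdzP[q qE] := FP (repr_nat x) (repr_nat y).
  exists (proj m q).
  have -> : x - y = proj n ((repr_nat x)%:Z - (repr_nat y)%:Z).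
    by rewrite /proj rmorphB /= -!/(proj n _) !proj_repr_nat.
  rewrite proj2_proj // -[in LHS](proj_repr_nat x) -[in LHS](proj_repr_nat y).
  by rewrite -!Ff /proj -rmorphB qE mulrC -rmorphM.
Qed.
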